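(* Let $\mu$ be a probability measure on $\mathbb{Z}$ for which there is a finite constant $C$ such that $|\widehat\mu(\gamma)-1|^2\le C\,(1-|\widehat\mu(\gamma)|)$ for all $\gamma\in\mathbb{C}$ with $|\gamma|=1$. Let $p>1$ and let $(n_k)_{k\ge1}$ be a sequence of positive integers with $n_{k+1}\ge n_k^{\,p}$ for all $k$. Then $$\sup_{|\gamma|=1}\sum_{k=1}^\infty\left|\widehat\mu(\gamma)^{n_{k+1}}-\widehat\mu(\gamma)^{n_k}\right|<\infty.$$
   Context: $\widehat\mu(\gamma)=\sum_{s\in\mathbb{Z}}\mu(s)\gamma^s$ for $|\gamma|=1$. *)

(* Defs.v *)
From HB Require Import structures.
From mathcomp Require Import all_boot all_order all_algebra.
From mathcomp Require Import all_classical all_reals all_analysis.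
From mathcomp Require Import summability.
From mathcomp Require Import complex.

Set Implicit Arguments.
Unset Strict Implicit.
Unset Printing Implicit Defensive.

Import Order.TTheory GRing.Theory Num.Theory numFieldNormedType.Exports.

Local Open Scope classical_set_scope.
Local Open Scope ring_scope.

HB.instance Definition _ := isPointed.Build int 0.

(* Every subset of Z is measurable, as for the library's instance on nat. *)
HB.instance Definition _ := @isMeasurable.Build default_measure_display
  int discrete_measurable discrete_measurable0
  discrete_measurableC discrete_measurableU.

(* The modulus as an element of R; the norm `|z| on R[i] takes values in R[i]. *)
Notation cmod := (@ComplexField.Normc.normc _).

(* [summability.sum] is the unordered sum of a family: the limit of the finite
   partial sums along the directed set of finite subsets of the index type.
   [R[i]^o] is R[i] as a normed space over itself. *)
Definition muhat (R : realType) (mu : probability int R) (g : R[i]) : R[i] :=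
  summability.sum
    (fun s : int => (real_complex R (fine (mu [set s])) * g ^ s : R[i]^o)).

(* Main.v *)
Require Import Defs.
From mathcomp Require Import all_boot all_order all_algebra.
From mathcomp Require Import all_classical all_reals all_analysis.
From mathcomp Require Import complex.
From mathcomp Require Import ring lra zify.
Import Order.TTheory GRing.Theory Num.Theory.
Import numFieldNormedType.Exports.

Local Open Scope classical_set_scope.
Local Open Scope ring_scope.

(** The proof uses [z := muhat mu g] only through [cmod z <= 1], from
    [cmod_muhat_le1], and [cmod (z - 1) ^+ 2 <= C * d] with [d := 1 - cmod z],
    so it is enough to bound the partial sums uniformly over all such [z].
    If [d = 0] then [z = 1] and every increment vanishes; let [d > 0].

    For exponents [a <= b] the increment [z ^+ b - z ^+ a] has modulus at most
    2, at most [b * sqrt (C * d)] since [z ^+ b - z ^+ a] is a product of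
    [z ^+ a] with a sum of at most [b] powers of [z] times [z - 1], and at most
    [2 / (a * d)] since [(1 - d) ^+ a * (1 + a * d) <= 1]
    ([cmod_increment_bounds]).  The second bound is good while the larger
    exponent is below [d ^ (-1/2)], the third one once the smaller exponent is
    above [d ^ (-1)].  Along exponents that at least double, either bound is
    dominated by a geometric series, with a total that does not depend on [d]
    ([sum_doubling_le], [sum_doubling_inv_le]).  Between the two thresholds the
    exponent is squared; as [n k.+1 >= n k `^ p], squaring takes at most [J]
    steps, where [p ^ J >= 2].  So at most [J + 1] terms fall in the gap
    ([sum_window_le]), and each of them is at most 2.

    The sequence [n] need not double from the start: it may equal 1 for some
    time.  Either it is constantly 1 and every increment vanishes, or it exceeds
    1 somewhere and then [n k `^ (p - 1) >= 2] from some index on, which depends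
    on [n] only; the finitely many earlier terms contribute at most 2 each. *)

(** * Sums along doubling sequences *)

(** The total mass before index [M] never exceeds [x M], as with
    [1 + 2 + ... + 2 ^ (M - 1) < 2 ^ M]. *)
Lemma sum_doubling_le (R : realFieldType) (x : nat -> R) (N : nat) :
  (forall k, 0 <= x k) -> (forall k, 2 * x k <= x k.+1) ->
  \sum_(k < N | x k <= 1) x k <= 2.
Proof.
move=> x0 x2.
have sx M : \sum_(k < M | x k <= 1) x k <= x M.
  elim: M => [|M IH]; first by rewrite big_ord0.
  rewrite big_mkcond big_ord_recr /= -big_mkcond /=.
  have := x2 M; have := x0 M; case: ifP => _; lra.
elim: N => [|N IH]; first by rewrite big_ord0.
rewrite big_mkcond big_ord_recr /= -big_mkcond /=.
have := sx N; case: ifP => h; lra.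
Qed.

Lemma sum_doubling_inv_le (R : realFieldType) (x : nat -> R) (N : nat) :
  (forall k, 0 < x k) -> (forall k, 2 * x k <= x k.+1) ->
  \sum_(k < N | 1 <= x k) (x k)^-1 <= 2.
Proof.
move=> x0 x2.
(* The first bound carries the induction: passing to the tail at least doubles
   its denominator, which leaves room for the head. *)
suff [] : \sum_(k < N | 1 <= x k) (x k)^-1 <= 2 / x 0 /\
          \sum_(k < N | 1 <= x k) (x k)^-1 <= 2 by [].
elim: N x x0 x2 => [|N IH] x x0 x2.
  by rewrite big_ord0 divr_ge0 ?ltW.
rewrite big_mkcond big_ord_recl /= -big_mkcond /=.
have [] := IH (fun k => x k.+1) (fun k => x0 _) (fun k => x2 _).
rewrite /bump /=; set S := \sum_(_ < _ | _) _ => Sx S2.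
have x12 : 2 / x 1 <= (x 0)^-1.
  by rewrite ler_pdivrMr// [leRHS]mulrC ler_pdivlMr.
have := x0 0; rewrite -invr_gt0 => ix0.
case: ifP => [x01|_]; last lra.
have := x0 0 => /invf_le1; rewrite x01 => h; lra.
Qed.

(** Once [b] has held at some index it fails from [J] indices later on, so all
    indices where it holds lie in one window of length [J]. *)
Lemma sum_window_le (b : nat -> bool) (J N : nat) :
  (forall k j, b k -> (J <= j)%N -> ~~ b (k + j)%N) ->
  (\sum_(k < N) b k <= J)%N.
Proof.
elim: N b => [|N IH] b bJ; first by rewrite big_ord0.
have [b0|b0] := boolP (b 0); last first.
  rewrite big_ord_recl /= (negbTE b0) add0n.
  by apply: (IH (fun k => b k.+1)) => k j; apply: (bJ k.+1).
have bE (k : 'I_N.+1) : (b k <= (k < J))%N.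
  have [Jk|] := leqP J k; last by case: (b k).
  by have := bJ 0 k b0 Jk; rewrite add0n => /negbTE ->.
have cnt M : (\sum_(k < M) (k < J) = minn M J)%N.
  by elim: M => [|M IHM]; rewrite ?big_ord0 ?big_ord_recr /= ?IHM; lia.
apply: (@leq_trans (\sum_(k < N.+1) (k < J))%N); last by rewrite cnt geq_minr.
by apply: leq_sum => k _; exact: bE.
Qed.

(** * The modulus of powers and of increments *)

Lemma cmod_ge0 {R : realType} (z : R[i]) : 0 <= cmod z.
Proof. by case: z => a b; rewrite /= sqrtr_ge0. Qed.

Lemma cmodX {R : realType} (z : R[i]) k : cmod (z ^+ k) = cmod z ^+ k.
Proof.
elim: k => [|k IH]; first by rewrite !expr0 ComplexField.Normc.normc1.
by rewrite !exprS ComplexField.Normc.normcM IH.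
Qed.

Lemma cmodB1X {R : realType} (z : R[i]) k :
  cmod z <= 1 -> cmod (z ^+ k - 1) <= k%:R * cmod (z - 1).
Proof.
move=> z1; elim: k => [|k IH].
  by rewrite expr0 subrr ComplexField.Normc.normc0 mul0r.
have -> : z ^+ k.+1 - 1 = z * (z ^+ k - 1) + (z - 1) by rewrite exprS; ring.
apply: le_trans (le_normcD _ _) _.
rewrite ComplexField.Normc.normcM -natr1 mulrDl mul1r lerD2r.
apply: le_trans IH.
by rewrite ler_piMl ?cmod_ge0.
Qed.

(** The first two bounds come from factoring out [z ^+ n].  The third is stated
    without division so that it covers [n = 0] and [cmod z = 1].  A negative [D]
    fits the second one, with [sqrt D = 0], since the hypothesis then forces
    [z = 1]. *)
Lemma cmod_increment_bounds (R : realType) (z : R[i]) (D : R) (m n : nat) :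
    cmod z <= 1 -> cmod (z - 1) ^+ 2 <= D * (1 - cmod z) -> (n <= m)%N ->
  [/\ cmod (z ^+ m - z ^+ n) <= 2,
      cmod (z ^+ m - z ^+ n) <= m%:R * (Num.sqrt D * Num.sqrt (1 - cmod z)) &
      cmod (z ^+ m - z ^+ n) * (n%:R * (1 - cmod z)) <= 2].
Proof.
move=> z1 zD nm.
have zE : cmod (z ^+ m - z ^+ n) = cmod z ^+ n * cmod (z ^+ (m - n) - 1).
  by rewrite -cmodX -ComplexField.Normc.normcM mulrBr mulr1 -exprD subnKC.
have z0 := cmod_ge0 z.
have zn1 k : cmod z ^+ k <= 1 by rewrite exprn_ile1.
have w2 : cmod (z ^+ (m - n) - 1) <= 2.
  apply: le_trans (le_normcD _ _) _.
  by rewrite normcN ComplexField.Normc.normc1 cmodX (natrD _ 1 1) lerD2r.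
have w0 := cmod_ge0 (z ^+ (m - n) - 1).
have zn0 : 0 <= cmod z ^+ n by rewrite exprn_ge0.
rewrite zE; split.
- by have := zn1 n; nra.
- apply: (@le_trans _ _ (cmod (z ^+ (m - n) - 1))); first by rewrite ler_piMl.
  apply: le_trans (cmodB1X _ _ z1) _.
  apply: ler_pM => //; [exact: cmod_ge0| by rewrite ler_nat leq_subr|].
  rewrite mulrC -sqrtrM ?subr_ge0// -[leLHS]ger0_norm ?cmod_ge0// -sqrtr_sqr.
  by rewrite ler_wsqrtr// mulrC.
- (* With [r := cmod z], the product does not increase with [k], because
     [1 + k (1 - r) - r (1 + (k + 1) (1 - r)) = (k + 1) (1 - r) ^ 2]. *)
  have h k : cmod z ^+ k * (1 + k%:R * (1 - cmod z)) <= 1.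
    elim: k => [|k IH]; first by rewrite expr0 mul0r addr0 mul1r.
    apply: le_trans IH; rewrite exprSr -mulrA ler_wpM2l ?exprn_ge0//.
    rewrite -subr_ge0 -natr1.
    rewrite (_ : _ - _ = (k%:R + 1) * (1 - cmod z) ^+ 2); last by ring.
    by rewrite mulr_ge0 ?addr_ge0 ?sqr_ge0.
  have Pd : cmod z ^+ n * (n%:R * (1 - cmod z)) <= 1.
    by apply: le_trans (h n); rewrite ler_wpM2l// lerDr.
  rewrite mulrAC -[leRHS]mul1r ler_pM// mulr_ge0// mulr_ge0// subr_ge0//.
Qed.

(** * The transform takes values in the closed unit disc *)

(** When the sum diverges, the limit operator returns the default point of
    [K^o], namely 0, for which the bound holds as well. *)
Lemma norm_sum_le (K : numFieldType) (I : choiceType) (x : I -> K^o) (M : K) :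
  (forall A, `|summability.partial_sum x A| <= M) -> `|summability.sum x| <= M.
Proof.
move=> xM; rewrite /summability.sum.
have [cx|/dvgP ->] :=
    pselect (cvg (summability.partial_sum x @ summability.totally)).
  apply/ler_addgt0Pr => e e0.
  have FF := @summability.totally_filter I.
  have [A /ltW] := @filter_ex _ _ FF _ (@cvgr_dist_lt _ _ _ _ _ _ _ cx e e0).
  set l := lim _ => lA.
  have -> : l = summability.partial_sum x A + (l - summability.partial_sum x A).
    by rewrite addrC subrK.
  by apply: le_trans (ler_normD _ _) _; apply: lerD.
by rewrite [point]/(0 : K^o) normr0; apply: le_trans (xM finmap.fset0).
Qed.

Lemma sum_fine_probability_le1 (R : realType) (mu : probability int R)
    (A : finmap.finset_of (Phant int)) :
  \sum_(s <- finmap.enum_fset A) fine (mu [set s]) <= 1.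
Proof.
rewrite sum_fine; last by move=> s _; apply: fin_num_measure.
rewrite fsbig_seq ?finmap.fset_uniq//.
rewrite -measure_fin_bigcup//; last first.
  by move=> s t _ _ [u []] /= -> .
rewrite -lee_fin fineK; last exact: fin_num_measure.
exact: probability_le1.
Qed.

Lemma cmod_muhat_le1 (R : realType) (mu : probability int R) (g : R[i]) :
  cmod g = 1 -> cmod (muhat mu g) <= 1.
Proof.
move=> g1.
have gz (s : int) : cmod (g ^ s) = 1.
  case: s => k; first by rewrite -exprnP cmodX g1 expr1n.
  by rewrite NegzE -exprnN ComplexField.Normc.normcV cmodX g1 expr1n invr1.
rewrite -lecR.
apply: norm_sum_le => A.
rewrite /summability.partial_sum.
rewrite -(finmap.big_seq_fsetE _ A xpredT
  (fun s : int => real_complex R (fine (mu [set s])) * g ^ s)) /=.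
apply: le_trans (ler_norm_sum _ _ _) _.
rewrite (eq_bigr (fun s => real_complex R (fine (mu [set s])))) => [|s _].
  by rewrite -rmorph_sum lecR; exact: sum_fine_probability_le1.
rewrite normrM (_ : `|g ^ s| = 1) ?mulr1; last first.
  by rewrite normc_def; case: (g ^ s) (gz s) => a b /= ->.
by rewrite ger0_norm// lecR fine_ge0.
Qed.

(** * Summing the increments *)

(** With [x k := n k.+1 * sqrt d] and [y k := n k * d], the term of index [k]
    falls under the second bound on increments when [x k <= 1] and under the
    third when [1 <= y k].  In the remaining case it is at most 2, and that
    happens at most [J.+1] times: if [1 < x k], then
    [y (k.+1 + J) >= n k.+1 ^ 2 * d = x k ^ 2 > 1]. *)
Lemma sum_increments_le (R : realType) (z : R[i]) (D : R) (n : nat -> nat)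
    (J N : nat) :
    cmod z <= 1 -> cmod (z - 1) ^+ 2 <= D * (1 - cmod z) ->
    (forall k, (0 < n k)%N) -> (forall k, (2 * n k <= n k.+1)%N) ->
    (forall k, (n k ^ 2 <= n (k + J))%N) ->
  \sum_(k < N) cmod (z ^+ n k.+1 - z ^+ n k) <=
    2 * Num.sqrt D + 2 * J.+1%:R + 4.
Proof.
move=> z1 zD n0 n2 nJ.
set d := 1 - cmod z in zD *.
have [d0|d0] : d = 0 \/ 0 < d by rewrite /d; lra.
  have : cmod (z - 1) ^+ 2 = 0.
    by apply/eqP; rewrite eq_le sqr_ge0 andbT (le_trans zD)// d0 mulr0.
  move/eqP; rewrite sqrf_eq0 => /eqP/ComplexField.Normc.eq0_normc/eqP.
  rewrite subr_eq0 => /eqP ->; rewrite big1 => [|k _].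
    by rewrite !addr_ge0 ?mulr_ge0 ?sqrtr_ge0.
  by rewrite !expr1n subrr ComplexField.Normc.normc0.
pose x k := (n k.+1)%:R * Num.sqrt d.
pose y k := (n k)%:R * d.
pose b k := (1 < x k) && (y k < 1).
have s0 : 0 < Num.sqrt d by rewrite sqrtr_gt0.
have y0 k : 0 < y k by rewrite mulr_gt0 ?ltr0n.
have n2R k : 2 * (n k)%:R <= (n k.+1)%:R :> R by rewrite -natrM ler_nat.
(* The three summands are the three cases; all are nonnegative, so their sum is
   a bound even where the cases overlap. *)
have term k : cmod (z ^+ n k.+1 - z ^+ n k) <=
    Num.sqrt D * (if x k <= 1 then x k else 0) + 2 * (b k)%:R +
    2 * (if 1 <= y k then (y k)^-1 else 0).
  have nk : (n k <= n k.+1)%N by have := n2 k; lia.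
  have [t2 tx ty] := cmod_increment_bounds R z D _ _ z1 zD nk.
  rewrite /b; have [xk|xk] := leP (x k) 1 => /=.
    have -> : Num.sqrt D * x k =
        (n k.+1)%:R * (Num.sqrt D * Num.sqrt (1 - cmod z)).
      by rewrite /x mulrCA.
    rewrite mulr0 addr0 (le_trans tx)// lerDl.
    case: ifP => _; rewrite mulr_ge0//.
    by rewrite invr_ge0 ltW.
  rewrite mulr0 add0r ltNge; case: (1 <= y k) => /=; last by lra.
  by rewrite mulr0 add0r -ler_pdivrMr ?invr_gt0// invrK.
apply: le_trans; first by apply: ler_sum => k _; exact: term.
rewrite !big_split /= -!mulr_sumr -!big_mkcond /=.
apply: lerD; first apply: lerD.
- rewrite mulrC ler_wpM2r ?sqrtr_ge0//; apply: sum_doubling_le => k.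
    by rewrite mulr_ge0 // ltW.
  by rewrite /x mulrA ler_wpM2r// ltW.
- rewrite -natr_sum ler_wpM2l// ler_nat; apply: sum_window_le => k j.
  case/andP => xk _ Jj; rewrite negb_and -leNgt -[X in _ || X]leNgt.
  apply/orP; right.
  have -> : (k + j = k.+1 + J + (j - J.+1))%N by lia.
  have nmono i : (n (k.+1 + J) <= n (k.+1 + J + i))%N.
    elim: i => [|i IH]; first by rewrite addn0.
    by rewrite addnS (leq_trans IH)//; have := n2 (k.+1 + J + i)%N; lia.
  have : 1 <= x k ^+ 2 by rewrite expr_ge1 ?ltW// (lt_trans _ xk).
  rewrite exprMn sqr_sqrtr ?(ltW d0)// => /le_trans; apply.
  rewrite /y ler_wpM2r ?(ltW d0)// -natrX ler_nat.
  exact: leq_trans (nJ _) (nmono _).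
- have -> : 4 = 2 * 2 :> R by ring.
  rewrite ler_wpM2l//; apply: sum_doubling_inv_le => // k.
  by rewrite /y mulrA ler_wpM2r// ltW.
Qed.

(** * Growth of the exponents *)

(** By Bernoulli, [p ^+ j >= 1 + j * (p - 1)]. *)
Lemma exists_exprn_ge (R : realType) (p A : R) : 1 < p -> exists j, A <= p ^+ j.
Proof.
move=> p1.
have h j : 1 + j%:R * (p - 1) <= p ^+ j.
  elim: j => [|j IH]; first by rewrite mul0r addr0 expr0.
  apply: (@le_trans _ _ (p * (1 + j%:R * (p - 1)))); last first.
    by rewrite exprS ler_wpM2l//; lra.
  rewrite -subr_ge0 -natr1 (_ : _ - _ = j%:R * (p - 1) ^+ 2); last by ring.
  by rewrite mulr_ge0 ?sqr_ge0.
exists (Num.truncn (A / (p - 1))).+1.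
apply: le_trans (h _); apply: ler_wpDl => //.
rewrite -ler_pdivrMr ?subr_gt0//; apply: ltW.
exact: truncnS_gt.
Qed.

Lemma powR_iter_le {R : realType} {p : R} {n : nat -> nat} :
    1 < p -> (forall k : nat, (1 <= k)%N -> (n k)%:R `^ p <= (n k.+1)%:R) ->
  forall k j, (1 <= k)%N -> (n k)%:R `^ (p ^+ j) <= (n (k + j)%N)%:R.
Proof.
move=> p1 hn k j k1; elim: j => [|j IH]; first by rewrite expr0 addn0 powRr1.
rewrite exprSr powRrM addnS; apply: le_trans (hn _ _); last by lia.
by apply: ge0_ler_powR; rewrite ?nnegrE ?powR_ge0// (le_trans ler01)// ltW.
Qed.

Lemma exists_square_lag {R : realType} {p : R} {n : nat -> nat} :
    1 < p -> (forall k : nat, (1 <= k)%N -> (0 < n k)%N) ->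
    (forall k : nat, (1 <= k)%N -> (n k)%:R `^ p <= (n k.+1)%:R) ->
  exists J, forall k, (1 <= k)%N -> (n k ^ 2 <= n (k + J))%N.
Proof.
move=> p1 n_gt0 hn.
have [J J2] := exists_exprn_ge R p 2 p1; exists J => k k1.
rewrite -(ler_nat R); apply: le_trans (powR_iter_le p1 hn k J k1).
by rewrite natrX -[leLHS]powR_mulrn// ler_powR// ler1n n_gt0.
Qed.

(** For [n k >= 2 ^ (p ^ j)] with [p ^ j >= 1 / (p - 1)], the factor
    [n k `^ (p - 1)] gained at each step is at least 2. *)
Lemma eventually_doubling {R : realType} {p : R} {n : nat -> nat} (k0 : nat) :
    1 < p -> (forall k : nat, (1 <= k)%N -> (n k)%:R `^ p <= (n k.+1)%:R) ->
  (1 <= k0)%N -> (1 < n k0)%N ->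
  exists j, forall k, (k0 + j <= k)%N -> (2 * n k <= n k.+1)%N.
Proof.
move=> p1 hn k01 nk0; have [j jp] := exists_exprn_ge R p (p - 1)^-1 p1.
exists j => k jk.
have k1 : (1 <= k)%N by lia.
rewrite -(ler_nat R) natrM; apply: le_trans (hn k k1).
rewrite -mulr_powRB1//; last exact: lt_trans ltr01 p1.
rewrite mulrC ler_wpM2l//.
have h : 2 `^ (p ^+ (k - k0)) <= (n k)%:R.
  have := powR_iter_le p1 hn k0 (k - k0) k01; rewrite subnKC; last by lia.
  apply: le_trans; apply: ge0_ler_powR; rewrite ?nnegrE ?exprn_ge0 ?ler_nat//.
  exact: le_trans ler01 (ltW p1).
apply: (@le_trans _ _ (2 `^ (p ^+ (k - k0)) `^ (p - 1))); last first.
  by apply: ge0_ler_powR; rewrite ?nnegrE ?powR_ge0 ?subr_ge0// ltW.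
rewrite -powRrM -[leLHS]powRr1// ler_powR//; first by rewrite ler1n.
rewrite -ler_pdivrMr ?subr_gt0// div1r (le_trans jp)//.
by apply: ler_weXn2l; [exact: ltW|lia].
Qed.

(** * The uniform bound *)

(** The index [K] from which [n] doubles and the lag [J] for squaring are
    chosen before [z]; [sum_increments_le] applies from [K] on. *)
Lemma partial_sums_bounded (R : realType) (D p : R) (n : nat -> nat) :
    1 < p -> (forall k : nat, (1 <= k)%N -> (0 < n k)%N) ->
    (forall k : nat, (1 <= k)%N -> (n k)%:R `^ p <= (n k.+1)%:R) ->
  exists B, forall (z : R[i]) N,
    cmod z <= 1 -> cmod (z - 1) ^+ 2 <= D * (1 - cmod z) ->
    \sum_(1 <= k < N) cmod (z ^+ n k.+1 - z ^+ n k) <= B.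
Proof.
move=> p1 n0 hn.
have [[k0 [k01 nk0]]|n1] :=
    pselect (exists k, (1 <= k)%N /\ (1 < n k)%N); last first.
  exists 0 => z N _ _; rewrite big_nat big1// => k /andP[k1 _].
  have nE i : (1 <= i)%N -> n i = 1%N.
    move=> i1; apply/eqP; rewrite eqn_leq n0// andbT leqNgt.
    by apply/negP => ni; apply: n1; exists i.
  by rewrite !nE// subrr ComplexField.Normc.normc0.
have [j nj] := eventually_doubling k0 p1 hn k01 nk0.
have [J nJ] := exists_square_lag p1 n0 hn.
set K := (k0 + j)%N.
exists (2 * K%:R + (2 * Num.sqrt D + 2 * J.+1%:R + 4)) => z N z1 zD.
have t0 k : 0 <= cmod (z ^+ n k.+1 - z ^+ n k) by exact: cmod_ge0.
have t2 k : cmod (z ^+ n k.+1 - z ^+ n k) <= 2.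
  apply: le_trans (le_normcD _ _) _.
  by rewrite normcN !cmodX (natrD _ 1 1) lerD// exprn_ile1// cmod_ge0.
apply: (@le_trans _ _ (\sum_(0 <= k < K + N) cmod (z ^+ n k.+1 - z ^+ n k))).
  have [N0|N1] := leqP N 1; first by rewrite big_geq// sumr_ge0.
  rewrite [leRHS](big_cat_nat (n := 1))//=; last by lia.
  rewrite [X in _ + X](big_cat_nat (n := N)) ?(ltnW N1) ?leq_addl//=.
  by rewrite addrCA lerDl addr_ge0// sumr_ge0.
rewrite (big_cat_nat (n := K)) ?leq_addr//=.
apply: lerD.
  rewrite -[K in leRHS]subn0 mulr_natr -sumr_const_nat.
  by apply: ler_sum => k _; exact: t2.
rewrite -{1}[K]add0n big_addn addKn big_mkord.
apply: (sum_increments_le R z D (fun k => n (k + K)%N) J N z1 zD) => k.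
- by apply: n0; lia.
- by rewrite addSn; apply: nj; lia.
- by rewrite addnAC; apply: nJ; lia.
Qed.

Theorem lemma4p3 (R : realType) (mu : probability int R)
  (hmu : exists C : R, forall g : R[i], cmod g = 1 ->
    cmod (muhat mu g - 1) ^+ 2 <= C * (1 - cmod (muhat mu g)))
  (p : R) (hp : 1 < p)
  (n : nat -> nat)
  (n_gt0 : forall k : nat, (1 <= k)%N -> (0 < n k)%N)
  (hn : forall k : nat, (1 <= k)%N -> (n k)%:R `^ p <= (n k.+1)%:R) :
  (ereal_sup [set (\sum_(1 <= k <oo)
      (cmod (muhat mu g ^+ n k.+1 - muhat mu g ^+ n k))%:E)%E
    | g in [set g : R[i] | (cmod g = 1)%R]] < +oo)%E.
Proof.
have [C muC] := hmu.
have [B hB] := partial_sums_bounded R C p n hp n_gt0 hn.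
apply: (@le_lt_trans _ _ B%:E); last exact: ltry.
apply: ge_ereal_sup => _ [g /= g1 <-].
apply: lime_le.
  by apply: is_cvg_nneseries => k _ _; rewrite lee_fin cmod_ge0.
apply: nearW => N; rewrite sumEFin lee_fin; apply: hB.
  exact: cmod_muhat_le1.
exact: muC.
Qed.
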